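(* Let $M\ge N\ge K\ge 2$, let $F:(\mathbb{R}^M,0)\to(\mathbb{R}^N,0)$ be an analytic map germ with $\mathrm{Disc}\,F=\{0\}$, let $G:(\mathbb{R}^N,0)\to(\mathbb{R}^K,0)$ be an analytic map germ, and let $H=G\circ F$. Then $$\mathrm{Sing}\,H\subset M(H)\subseteq M(F)\cup\mathrm{Sing}\,H.$$ In particular, if $\{0\}\subseteq\mathrm{Sing}\,G$, then $M(H)\setminus\mathrm{Sing}\,H\subseteq M(F)\setminus V_F$.
   Context: Map germs are non-constant and all sets are considered as germs at the origin. For a map germ $F:(\mathbb{R}^M,0)\to(\mathbb{R}^N,0)$, put $V_F=F^{-1}(0)$ and let $\mathrm{Sing}\,F$ be the set of points $x$ where the Jacobian matrix $\mathrm{d}F(x)$ does not have maximal rank (rank less than $N$, i.e. $F$ is not a submersion at $x$). $\mathrm{Disc}\,F=F(\mathrm{Sing}\,F)$; the condition $\mathrm{Disc}\,F=\{0\}$ means $\mathrm{Sing}\,F\subseteq V_F$. Fix a smooth nonnegative proper function $\rho:U\to\mathbb{R}_{\ge0}$, defined on an open neighbourhood $U$ of $0\in\mathbb{R}^M$ and vanishing only at the origin (for example $\rho(x)=\|x\|^2$). The Milnor set is $M(F)=M_\rho(F)=\mathrm{Sing}(F,\rho)$, the set of points where $(F,\rho)$ is not a submersion to $\mathbb{R}^{N+1}$; $M(H)=\mathrm{Sing}(H,\rho)$ is defined likewise with the same $\rho$. The symbol $\subset$ denotes (not necessarily strict) inclusion. *)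

(* Defs.v *)
From HB Require Import structures.
From mathcomp Require Import all_boot all_order all_algebra finmap.
From mathcomp Require Import all_classical all_reals all_analysis.
From mathcomp Require Import summability.

Set Implicit Arguments.
Unset Strict Implicit.
Unset Printing Implicit Defensive.

Import Order.TTheory GRing.Theory Num.Theory.
Import numFieldNormedType.Exports.

Local Open Scope classical_set_scope.
Local Open Scope ring_scope.

(* A map germ at the origin is represented by a total function; its values
   away from 0 never matter, because everything below is stated near 0. *)

Section Germs.
Context {R : realType}.

Definition germ_subset n (A B : set 'rV[R]_n) : Prop :=
  \forall x \near (0 : 'rV[R]_n), A x -> B x.

Definition monomial n (alpha : {ffun 'I_n -> nat}) (x : 'rV[R]_n) : R :=
  \prod_(i < n) x 0 i ^+ alpha i.

(* Convergence along the net of finite sets of multi-indices is unconditional,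
   hence absolute, convergence of the power series. *)
Definition analytic_at n m (f : 'rV[R]_n -> 'rV[R]_m) (a : 'rV[R]_n) : Prop :=
  exists c : {ffun 'I_n -> nat} -> 'rV[R]_m,
    \forall x \near a,
      partial_sum (fun alpha => monomial alpha (x - a) *: c alpha) @ totally
        --> f x.

Definition analytic_map_germ n m (f : 'rV[R]_n -> 'rV[R]_m) : Prop :=
  [/\ f 0 = 0,
      \forall a \near (0 : 'rV[R]_n), analytic_at f a
    & ~ (\forall x \near (0 : 'rV[R]_n), f x = f 0)].

Definition zero_locus n m (f : 'rV[R]_n -> 'rV[R]_m) : set 'rV[R]_n :=
  [set x | f x = 0].

(* ['J f x] acts on row vectors, so it is the transpose of the usual m x n
   Jacobian matrix; the rank is the same. *)
Definition Sing n m (f : 'rV[R]_n -> 'rV[R]_m) : set 'rV[R]_n :=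
  [set x | (\rank ('J f x) < m)%N].

(* Disc f = {0}.  The image of a set germ under a map germ need not be a
   well-defined set germ, so the condition is read on the source, as the
   inclusion of germs Sing f `<=` f^-1(0). *)
Definition Disc_trivial n m (f : 'rV[R]_n -> 'rV[R]_m) : Prop :=
  germ_subset (Sing f) (zero_locus f).

Definition partials n (s : seq 'I_n) (f : 'rV[R]_n -> R) : 'rV[R]_n -> R :=
  foldr (fun i g => 'D_(delta_mx 0 i) g) f s.

Definition smooth_on n (U : set 'rV[R]_n) (f : 'rV[R]_n -> R) : Prop :=
  forall (s : seq 'I_n) (x : 'rV[R]_n), U x ->
    {for x, continuous (partials s f)} /\
    forall i : 'I_n, derivable (partials s f) x (delta_mx 0 i).

(* Properness is that of rho as a map from U to the nonnegative reals. *)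
Definition control_function n (U : set 'rV[R]_n) (rho : 'rV[R]_n -> R) : Prop :=
  [/\ smooth_on U rho,
      forall x, U x -> 0 <= rho x,
      forall C : set R, C `<=` [set t | 0 <= t] -> compact C ->
        compact (U `&` rho @^-1` C)
    & forall x, U x -> (rho x = 0 <-> x = 0)].

Definition pair_rho n m (f : 'rV[R]_n -> 'rV[R]_m) (rho : 'rV[R]_n -> R)
    (x : 'rV[R]_n) : 'rV[R]_(m + 1) :=
  row_mx (f x) (rho x)%:M.

Definition Milnor_set n m (rho : 'rV[R]_n -> R) (f : 'rV[R]_n -> 'rV[R]_m) :
    set 'rV[R]_n :=
  Sing (pair_rho f rho).

End Germs.

(* Main.v *)
From HB Require Import structures.
Require Import Defs.
From mathcomp Require Import all_boot all_order all_algebra finmap.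
From mathcomp Require Import all_classical all_reals all_analysis.
From mathcomp Require Import summability ring.

(** Near the origin [F], [G] and [rho] are differentiable, so the Jacobian of
    [(F, rho)] at [x] is that of [F] with the column [grad rho] appended.  Hence
    [x] lies in [M(F)] iff [x] is in [Sing F] or [grad rho] lies in the span of
    the gradients of the components of [F].  By the chain rule the gradients of
    [H] are combinations of those of [F], which gives [M(H) <= M(F) u Sing H];
    the chain rule also gives [F x \in Sing G -> x \in Sing H], so [V_F] is
    contained in [Sing H] as soon as [0] is in [Sing G]. *)

Set Implicit Arguments.
Unset Strict Implicit.
Unset Printing Implicit Defensive.

Import Order.TTheory GRing.Theory Num.Theory.
Import numFieldNormedType.Exports.

Local Open Scope classical_set_scope.
Local Open Scope ring_scope.

(** * Rank of a matrix with an appended column *)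

(** After transposing, [c^T] is one extra row, which raises the rank by at most one. If [A] already
    has rank [m], the rank stays [m] exactly when this row lies in the old row space. *)
Lemma rank_row_mx_col (R : fieldType) n m (A : 'M[R]_(n, m)) (c : 'cV[R]_n) :
  (\rank (row_mx A c) < m + 1)%N = (\rank A < m)%N || (c^T <= A^T)%MS.
Proof.
rewrite -mxrank_tr tr_row_mx -addsmxE addn1 ltnS.
rewrite -[\rank A]mxrank_tr.
have [Alt|Age] /= := ltnP (\rank A^T) m.
  apply: leq_trans (mxrank_adds_leqif _ _) _.
  by rewrite (leq_trans _ Alt)// -[X in (_ <= X)%N]addn1 leq_add2l rank_leq_row.
have {Age} rA : \rank A^T = m by apply/eqP; rewrite eqn_leq rank_leq_row.
have := mxrank_leqif_sup (addsmxSl A^T c^T).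
move=> [le1 eq1]; rewrite addsmx_sub submx_refl /= in eq1.
by rewrite -eq1 eqn_leq le1 /= rA.
Qed.

(** * Sup norm and criteria for differentiability *)

Lemma mx_entry_le_norm (R : realFieldType) m n (x : 'M[R]_(m, n)) i j :
  `|x i j| <= `|x|.
Proof.
by rewrite [leRHS]/Num.norm/= mx_normrE; exact: (le_bigmax _ _ (i, j)).
Qed.

Lemma mx_norm_le (R : realFieldType) m n (x : 'M[R]_(m, n)) e :
  0 <= e -> (forall i j, `|x i j| <= e) -> `|x| <= e.
Proof.
move=> e0 xe; rewrite [leLHS]/Num.norm/= mx_normrE.
by apply: bigmax_le => // -[i j] _; exact: xe.
Qed.

(** By [diff_unique], a first-order expansion with continuous linear part [df] forces [df] to be the
    differential. *)
Lemma differentiable_approx (R : realFieldType) (V W : normedModType R)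
    (f : V -> W) (df : {linear V -> W}) x :
  continuous df ->
  (forall e, 0 < e ->
     \forall h \near 0, `|f (h + x) - f x - df h| <= e * `|h|) ->
  differentiable f x.
Proof.
move=> cdf fdf.
have E : f \o shift x = cst (f x) + df +o_ 0 id.
  apply/eqaddoP => e e0; near=> h.
  rewrite /= -![(_ - _ : _ -> _) _]/(_ - _) -![(_ + _ : _ -> _) _]/(_ + _).
  by rewrite /= opprD addrA; near: h; exact: fdf.
by apply/diff_locallyP; rewrite (diff_unique cdf E).
Unshelve. all: by end_near. Qed.

Lemma differentiable_rV (R : numFieldType) (V : normedModType R) m
    (f : V -> 'rV[R]_m) x :
  (forall j, differentiable (fun y => f y 0 j) x) -> differentiable f x.
Proof.
move=> df.
have -> : f = \sum_(j < m) (fun y => f y 0 j *: delta_mx 0 j).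
  by apply/funext => y; rewrite fct_sumE; exact: row_sum_delta.
by apply: differentiable_sum => j; exact: differentiableZl.
Qed.

(** * Jacobian matrices of composites and of [pair_rho] *)

Lemma jacobian_comp (R : realType) n p m (f : 'rV[R]_n -> 'rV[R]_p)
    (g : 'rV[R]_p -> 'rV[R]_m) x :
  differentiable f x -> differentiable g (f x) ->
  'J (g \o f) x = 'J f x *m 'J g (f x).
Proof.
move=> df dg; apply/row_matrixP => i.
by rewrite !rowE mulmxA /jacobian !mul_rV_lin1/= diff_comp.
Qed.

Lemma pair_rho_differentiable (R : realType) n m (f : 'rV[R]_n -> 'rV[R]_m)
    (rho : 'rV[R]_n -> R) x :
  differentiable f x -> differentiable rho x ->
  differentiable (pair_rho f rho) x.
Proof.
move=> df drho; apply: differentiable_rV => j; rewrite -(splitK j).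
case: (fintype.split j) => k /=.
  rewrite (_ : (fun y => _) = (fun u : 'rV_m => u 0 k) \o f).
    by apply: differentiable_comp => //; exact: differentiable_coord.
  by apply/funext => y; rewrite /= row_mxEl.
rewrite (_ : (fun y => _) = rho) //.
by apply/funext => y; rewrite row_mxEr ord1 mxE eqxx mulr1n.
Qed.

Lemma jacobianE (R : realFieldType) n m (f : 'rV[R]_n -> 'rV[R]_m) x i j :
  differentiable f x ->
  'J f x i j = 'D_(delta_mx 0 i) (fun y => f y 0 j) x.
Proof.
move=> df; have -> : 'J f x i j = ((delta_mx 0 i : 'rV_n) *m 'J f x) 0 j.
  by rewrite -rowE [RHS]mxE.
rewrite -deriveEjacobian// derive_mx; last exact: diff_derivable.
by rewrite mxE.
Qed.

Lemma jacobian_pair_rho (R : realType) n m (f : 'rV[R]_n -> 'rV[R]_m)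
    (rho : 'rV[R]_n -> R) x :
  differentiable f x -> differentiable rho x ->
  'J (pair_rho f rho) x =
  row_mx ('J f x) (\col_i 'D_(delta_mx 0 i) rho x).
Proof.
move=> df drho; have dp := pair_rho_differentiable df drho.
apply/matrixP => i j; rewrite jacobianE// -(splitK j).
case: (fintype.split j) => k /=.
  rewrite [RHS]row_mxEl (jacobianE _ _ df).
  rewrite (_ : (fun y => pair_rho f rho y 0 _) = fun y => f y 0 k)//.
  by apply/funext => y; exact: row_mxEl.
rewrite [RHS]row_mxEr [RHS]mxE.
rewrite (_ : (fun y => pair_rho f rho y 0 _) = rho)//.
by apply/funext => y; rewrite [LHS]row_mxEr ord1 mxE eqxx mulr1n.
Qed.

(** * Continuous partial derivatives imply differentiability *)

Lemma differentiable_rV_approx (R : realType) n (f : 'rV[R]_n -> R)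
    (d : 'I_n -> R) x :
  (forall e, 0 < e -> \forall h \near (0 : 'rV[R]_n),
     `|f (h + x) - f x - \sum_i h 0 i * d i| <= e * `|h|) ->
  differentiable f x.
Proof.
pose D (h : 'rV[R]_n) : R := \sum_i h 0 i * d i.
have linD : linear D.
  move=> a u v; rewrite /D scaler_sumr -big_split/=; apply: eq_bigr => i _.
  by rewrite !mxE mulrDl -mulrA.
pose DL : {linear 'rV[R]_n -> R} :=
  HB.pack D (GRing.isLinear.Build _ _ _ _ _ linD).
move=> fd; apply: (@differentiable_approx _ _ _ _ DL) => //.
move=> y; apply: differentiable_continuous.
rewrite (_ : (DL : 'rV_n -> R) = \sum_i (fun h : 'rV_n => h 0 i) * cst (d i)).
  by apply: differentiable_sum => i; apply: differentiableM => //;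
    exact: differentiable_coord.
by apply/funext => h; rewrite fct_sumE.
Qed.

(** The one-variable mean value theorem on the line [t *: v + p]. Both signs of [a] are treated
    because [a] will be a coordinate of an arbitrary displacement. *)
Lemma directional_MVT (R : realType) (V : normedModType R) (f : V -> R)
    (p v : V) (a : R) :
  (forall t, `|t| <= `|a| -> derivable f (t *: v + p) v) ->
  exists2 t, `|t| <= `|a| &
    f (a *: v + p) - f p = a * 'D_v f (t *: v + p).
Proof.
move=> df; pose g t := f (t *: v + p).
have dg (t : R) : `|t| <= `|a| -> is_derive t (1 : R) g ('D_v f (t *: v + p)).
  (* The two difference quotients agree as functions of [h], so derivability and the derivative
     transfer together. *)
  move=> ta; have E : (fun h => h^-1 *: ((g \o shift t) (h *: (1 : R)) - g t)) =
      (fun h => h^-1 *: ((f \o shift (t *: v + p)) (h *: v) - f (t *: v + p))).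
    apply/funext => h; rewrite /g /=; congr (_ *: (f _ - _)).
    by rewrite [_ *: 1]mulr1 scalerDl addrA.
  by split; rewrite /derivable /derive E//; exact: df.
have dgo (t : R) : `|t| <= `|a| -> derivable g t (1 : R) by move=> /dg [].
have [a0|a0] := lerP 0 a.
- have [||t] := @MVT_segment R g (fun t => 'D_v f (t *: v + p)) 0 a a0.
  + by move=> t /[!in_itv]/= /andP[t0 ta]; apply: dg; rewrite !ger0_norm// ltW.
  + apply: derivable_within_continuous => t /[!in_itv]/= /andP[t0 ta].
    by apply: dgo; rewrite !ger0_norm.
  move=> /[!in_itv]/= /andP[t0 ta]; rewrite subr0 /g scale0r add0r => E.
  by exists t; [rewrite !ger0_norm|rewrite E mulrC].
- have [||t] := @MVT_segment R g (fun t => 'D_v f (t *: v + p)) a 0 (ltW a0).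
  + move=> t /[!in_itv]/= /andP[t0 ta]; apply: dg.
    by rewrite !ltr0_norm// lerN2 ltW.
  + apply: derivable_within_continuous => t /[!in_itv]/= /andP[t0 ta].
    by apply: dgo; rewrite (ltr0_norm a0) ler0_norm// lerN2.
  move=> /[!in_itv]/= /andP[t0 ta]; rewrite sub0r /g scale0r add0r => E.
  exists t; first by rewrite (ltr0_norm a0) ler0_norm// lerN2.
  by rewrite -opprB E mulrN opprK mulrC.
Qed.

(** Move from [x] to [h + x] one coordinate at a time. On each segment the mean value theorem gives
    [h 0 i] times a partial derivative at a point near [x], close to the one at [x] by
    continuity. *)
Lemma C1_differentiable (R : realType) n (f : 'rV[R]_n -> R) x :
  (\forall y \near x, forall i, derivable f y (delta_mx 0 i)) ->
  (forall i, {for x, continuous ('D_(delta_mx 0 i) f)}) ->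
  differentiable f x.
Proof.
move=> df cdf; apply: (@differentiable_rV_approx _ _ _
  (fun i => 'D_(delta_mx 0 i) f x)) => e e0.
(* The [n] coordinate steps each cost at most [e' * |h|]; dividing by [n.+1] keeps the divisor
   nonzero when [n = 0]. *)
pose e' := e / n.+1%:R.
have e'0 : 0 < e' by rewrite divr_gt0.
have : \forall y \near x, forall i, derivable f y (delta_mx 0 i) /\
    `|'D_(delta_mx 0 i) f x - 'D_(delta_mx 0 i) f y| <= e'.
  near=> y => i; split; first by move: i; near: y; exact: df.
  move: i; near: y; apply: filter_forall => i.
  by have /cvgrPdist_le := cdf i; apply.
move=> /nbhs_ballP[r /= r0 xr]; near=> h.
have hr : `|h| < r by near: h; apply: (@nbhs0_lt R 'rV[R]_n).
(* The corners of the path: [w k] keeps the first [k] coordinates of [h], so [w 0] is zero and [w n]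
   is [h]. *)
pose w k : 'rV[R]_n := \row_j (if (j < k)%N then h 0 j else 0).
have step (i : 'I_n) : exists2 d, `|'D_(delta_mx 0 i) f x - d| <= e' &
    f (w i.+1 + x) - f (w i + x) = h 0 i * d.
  have wS : w i.+1 + x = h 0 i *: delta_mx 0 i + (w i + x).
    apply/rowP => j; rewrite !mxE eqxx/= addrA ltnS leq_eqVlt.
    have [->|ij] := eqVneq j i; first by rewrite eqxx ltnn mulr1 addr0.
    by rewrite (negPf ij : (j : nat) == i = false) mulr0 add0r.
  (* The [i]-th coordinate of [w i] is zero, so every coordinate of the displacement is [t], some
     [h 0 j] or zero, and its sup norm is at most [|h|]. *)
  have near_x t : `|t| <= `|h 0 i| -> ball x r (t *: delta_mx 0 i + (w i + x)).
    move=> ti; rewrite -ball_normE/= addrA opprD addrCA subrr addr0 normrN.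
    apply: le_lt_trans hr; apply: mx_norm_le => // k j.
    rewrite ord1 !mxE eqxx/=; have [->|ij] := eqVneq j i.
      rewrite ltnn addr0 mulr1; apply: le_trans ti _; exact: mx_entry_le_norm.
    rewrite mulr0 add0r; case: ifP => _; first exact: mx_entry_le_norm.
    by rewrite normr0.
  have [|t th E] := @directional_MVT _ _ f (w i + x) (delta_mx 0 i) (h 0 i).
    by move=> t /near_x/xr/(_ i)[].
  exists ('D_(delta_mx 0 i) f (t *: delta_mx 0 i + (w i + x))).
    by have [_] := xr _ (near_x _ th) i.
  by rewrite wS.
have -> : f (h + x) - f x = \sum_(i < n) (f (w i.+1 + x) - f (w i + x)).
  rewrite -(big_mkord xpredT (fun k => f (w k.+1 + x) - f (w k + x))).
  rewrite telescope_sumr//; congr (f _ - f _).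
    by congr (_ + _); apply/rowP => j; rewrite mxE ltn_ord.
  by rewrite -[LHS]add0r; congr (_ + _); apply/rowP => j; rewrite !mxE.
rewrite -sumrB; apply: le_trans (ler_norm_sum _ _ _) _.
have le1 (i : 'I_n) : true ->
    `|f (w i.+1 + x) - f (w i + x) - h 0 i * 'D_(delta_mx 0 i) f x| <=
    `|h| * e'.
  move=> _; have [d de ->] := step i.
  rewrite -mulrBr normrM distrC; apply: ler_pM => //.
  exact: mx_entry_le_norm.
apply: le_trans (ler_sum _ le1) _.
rewrite sumr_const card_ord -mulrnAr mulrC; apply: ler_wpM2r => //.
by rewrite /e' -mulrnAl ler_pdivrMr// -[e *+ _]mulr_natr ler_pM2l// ler_nat.
Unshelve. all: by end_near. Qed.

(** * Unconditionally convergent families *)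

Lemma partial_sumE (I : choiceType) (V : zmodType) (u : I -> V) (A : {fset I}) :
  partial_sum u A = \sum_(i <- A) u i.
Proof. by rewrite big_seq_fsetE. Qed.

Lemma totally_cvg_dist (R : realType) (I : choiceType) (u : I -> R) (l : R) e :
  partial_sum u @ totally --> l -> 0 < e ->
  exists A : {fset I}, forall B, (A `<=` B)%fset ->
    `|l - \sum_(i <- B) u i| < e.
Proof.
move=> ul e0; have [A _ AP] := ul _ (nbhsx_ballx l e e0).
exists A => B AB; have := AP B AB.
by rewrite /= -ball_normE/= partial_sumE.
Qed.

Lemma big_fset_subsetD (V : zmodType) (I : choiceType) (u : I -> V)
    (A B : {fset I}) : (A `<=` B)%fset ->
  \sum_(i <- B) u i = \sum_(i <- A) u i + \sum_(i <- (B `\` A)%fset) u i.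
Proof.
move=> AB; rewrite (big_fsetID _ (mem A)); congr (_ + _);
  apply: perm_big; apply: uniq_perm => //; move=> i; rewrite !inE.
  by apply/andP/idP => [[]//|iA]; rewrite (fsubsetP AB).
by rewrite andbC.
Qed.

(** Convergence along finite sets bounds all finite subsums uniformly, and among terms of one sign
    no cancellation occurs. *)
Lemma totally_cvg_norm_bounded (R : realType) (I : choiceType) (u : I -> R)
    (l : R) :
  partial_sum u @ totally --> l ->
  exists C, forall A : {fset I}, \sum_(i <- A) `|u i| <= C.
Proof.
move=> ul; have [A AP] := totally_cvg_dist ul ltr01.
(* The three terms bound the limit, the distance to it of any sum containing [A], and any correction
   by indices of [A]. *)
pose C := `|l| + 1 + \sum_(i <- A) `|u i|.
(* A sum over [D] is a sum over [A `|` D], which is near [l], minus one over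
   [A `\` D]. *)
have bnd (D : {fset I}) : `|\sum_(i <- D) u i| <= C.
  have -> : \sum_(i <- D) u i = l - (l - \sum_(i <- (A `|` D)%fset) u i)
      - \sum_(i <- (A `\` D)%fset) u i.
    rewrite subKr (big_fset_subsetD _ (fsubsetUr A D)).
    by rewrite fsetDUl fsetDv fsetU0 addrK.
  apply: le_trans (ler_normB _ _) _; apply: lerD.
    apply: le_trans (ler_normB _ _) _; rewrite lerD2l ltW// AP//.
    exact: fsubsetUl.
  apply: le_trans (ler_norm_sum _ _ _) _.
  rewrite (big_fset_subsetD _ (fsubsetDl A D)) lerDl.
  exact: sumr_ge0.
exists (C + C) => D; rewrite (big_fsetID _ (fun i => 0 <= u i)) /=.
apply: lerD.
  apply: le_trans (bnd [fset x in D | 0 <= u x]%fset).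
  apply: le_trans (ler_norm _).
  rewrite !big_seq; apply: ler_sum => i; rewrite !inE => /andP[_ ui].
  by rewrite ger0_norm.
apply: le_trans (bnd [fset x in D | ~~ (0 <= u x)]%fset).
rewrite -normrN; apply: le_trans (ler_norm _); rewrite -sumrN.
rewrite !big_seq; apply: ler_sum => i; rewrite !inE -ltNge => /andP[_ ui].
by rewrite ltr0_norm.
Qed.

(** * Differentiability of a power series at its centre *)

Section PowerSeries.
Variables (R : realType) (n : nat).
Implicit Types (alpha : {ffun 'I_n -> nat}) (h : 'rV[R]_n).

Let mdeg alpha := (\sum_i alpha i)%N.

Let unit_index (i : 'I_n) : {ffun 'I_n -> nat} := [ffun j => (j == i : nat)].

(** The multi-indices of degree at most 1: their terms give the value and the differential at the
    centre. *)
Let affine_indices : {fset {ffun 'I_n -> nat}} :=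
  ([ffun=> 0%N] |` [fset unit_index i | i in 'I_n])%fset.

Let monomial_le h s alpha : `|h| <= s -> `|monomial alpha h| <= s ^+ mdeg alpha.
Proof.
move=> hs; rewrite /monomial normr_prod /mdeg -prodrXr; apply: ler_prod => i _.
rewrite normr_ge0/= normrX; apply: lerXn2r; rewrite ?nnegrE//.
  exact: le_trans hs.
by apply: le_trans hs; exact: mx_entry_le_norm.
Qed.

Let monomial_const s alpha :
  monomial alpha (const_mx s : 'rV[R]_n) = s ^+ mdeg alpha.
Proof.
by rewrite /monomial /mdeg -prodrXr; apply: eq_bigr => i _; rewrite mxE.
Qed.

(** Some [alpha i] is positive, and [alpha] differs from [unit_index i] at some [j]: either [j = i]
    and [alpha i] is at least 2, or [alpha j] is a second positive exponent. *)
Let mdeg_ge2 alpha : alpha \notin affine_indices -> (2 <= mdeg alpha)%N.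
Proof.
rewrite !inE negb_or => /andP[alpha0 alpha1].
have [i ai] : exists i, (0 < alpha i)%N.
  apply/existsP; apply: contraR alpha0; rewrite negb_exists => /forallP a0.
  by apply/eqP/ffunP => i; rewrite ffunE; apply/eqP; rewrite -leqn0 leqNgt a0.
have [j aj] : exists j, alpha j != (j == i).
  apply/existsP; apply: contraR alpha1; rewrite negb_exists => /forallP a1.
  apply/imfsetP; exists i => //=.
  by apply/ffunP => j; rewrite ffunE; apply/eqP; have := a1 j; rewrite negbK.
rewrite /mdeg (bigD1 i)//=; have [ji|ji] := eqVneq j i.
  apply: leq_trans (leq_addr _ _).
  by move: aj; rewrite ji eqxx; case: (alpha i) ai => [|[]].
rewrite (bigD1 j)//= addnA; apply: leq_trans (leq_addr _ _).
by move: aj; rewrite (negPf ji); case: (alpha j) => // k _;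
  rewrite addnS ltnS (leq_trans ai)// leq_addr.
Qed.

Let sum_affine_indices (c : {ffun 'I_n -> nat} -> R) h :
  \sum_(alpha <- affine_indices) monomial alpha h * c alpha =
  c [ffun=> 0%N] + \sum_i h 0 i * c (unit_index i).
Proof.
rewrite /affine_indices big_fsetU1/=; last first.
  apply/imfsetP => -[/= i _ /ffunP/(_ i)].
  by rewrite !ffunE eqxx.
congr (_ + _).
  by rewrite /monomial big1 ?mul1r// => i _; rewrite ffunE expr0.
rewrite big_imfset/=; last first.
  move=> i j _ _ /ffunP/(_ i); rewrite !ffunE eqxx.
  by case: eqP.
rewrite big_enum/=; apply: eq_bigr => i _; congr (_ * _).
rewrite /monomial (bigD1 i)//= ffunE eqxx expr1 big1 ?mulr1// => j ji.
by rewrite ffunE (negPf ji) expr0.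
Qed.

(* Only convergence at the corner [a + (s, ..., s)] is used for the bound: there
   the series sums absolutely to at most [C0], and for [`|h| <= s] a term of
   degree at least 2 is at most [(`|h| / s)^2] times its value at the corner. *)
Lemma power_series_differentiable (c : {ffun 'I_n -> nat} -> R)
    (f : 'rV[R]_n -> R) (a : 'rV[R]_n) :
  (\forall x \near a,
     partial_sum (fun alpha => monomial alpha (x - a) * c alpha) @ totally
       --> f x) ->
  differentiable f a.
Proof.
move=> /nbhs_ballP[r /= r0 fc].
pose s := r / 2.
have s0 : 0 < s by rewrite divr_gt0.
have {}fc h : `|h| <= s ->
    partial_sum (fun alpha => monomial alpha h * c alpha) @ totally
      --> f (h + a).
  move=> hs; have := fc (h + a); rewrite addrK; apply.
  rewrite -ball_normE/= opprD addrCA subrr addr0 normrN.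
  by apply: le_lt_trans hs _; rewrite ltr_pdivrMr// mulr_natr mulr2n ltrDl.
have [C0 C0P] : exists C, forall A : {fset {ffun 'I_n -> nat}},
    \sum_(alpha <- A) `|s ^+ mdeg alpha * c alpha| <= C.
  have /fc/totally_cvg_norm_bounded[C CP] : `|const_mx s : 'rV[R]_n| <= s.
    by apply: mx_norm_le => [|i j]; rewrite ?mxE ?gtr0_norm// ltW.
  by exists C => A; under eq_bigr do rewrite -monomial_const.
have C00 : 0 <= C0 by apply: le_trans (C0P fset0); exact: sumr_ge0.
pose L h := \sum_i h 0 i * c (unit_index i).
have est h : `|h| <= s ->
    `|f (h + a) - (c [ffun=> 0%N] + L h)| <= C0 / s ^+ 2 * `|h| ^+ 2.
  (* Finite sums reach [f (h + a)] only up to [e]. Adjoining the affine indices to such a sum leaves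
     a tail [T] of terms of degree at least 2. *)
  move=> hs; apply/ler_addgt0Pr => e e0.
  have [A AP] := totally_cvg_dist (fc _ hs) e0.
  have := AP _ (fsubsetUl A affine_indices).
  rewrite (big_fset_subsetD _ (fsubsetUr A affine_indices)).
  rewrite sum_affine_indices -/(L h) => Ae.
  set T := \sum_(i <- _) _ in Ae.
  have TC : `|T| <= C0 / s ^+ 2 * `|h| ^+ 2.
    apply: le_trans (ler_norm_sum _ _ _) _.
    rewrite -mulrA mulrC; apply: le_trans (ler_wpM2l _ (C0P _)); last first.
      by rewrite mulr_ge0// ?exprn_ge0// invr_ge0 exprn_ge0// ltW.
    rewrite mulr_sumr !big_seq; apply: ler_sum => alpha.
    rewrite inE => /andP[/mdeg_ge2 /subnKC deg _].
    rewrite !normrM mulrA; apply: ler_wpM2r => //.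
    apply: le_trans (monomial_le _ (lexx _)) _.
    (* Split the degree as 2 plus the rest: [s ^+ 2] cancels against its inverse, and [|h| <= s]
       handles the remaining power. *)
    rewrite -deg !exprD normrM (ger0_norm (exprn_ge0 2 (ltW s0))).
    rewrite mulrA -[X in _ <= X * _]mulrA mulrCA mulVf ?mulr1; last first.
      by rewrite expf_neq0// gt_eqF.
    apply: ler_wpM2l; first exact: exprn_ge0.
    rewrite (ger0_norm (exprn_ge0 _ (ltW s0))).
    by apply: lerXn2r; rewrite ?nnegrE// ltW.
  rewrite (_ : f _ - _ = T + (f (h + a) - (c [ffun=> 0%N] + L h + T)));
    last by ring.
  by apply: le_trans (ler_normD _ _) _; apply: lerD => //; exact: ltW.
have fa : f a = c [ffun=> 0%N].
  have := est 0; rewrite normr0 add0r expr0n mulr0 => /(_ (ltW s0)).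
  rewrite normr_le0 subr_eq0 => /eqP ->.
  by rewrite /L big1 ?addr0// => i _; rewrite mxE mul0r.
apply: (@differentiable_rV_approx _ _ _ (c \o unit_index)) => e e0.
(* Adding 1 keeps [k] positive when [C0 = 0]; then [|h| <= e / k] makes the quadratic remainder at
   most [e * |h|]. *)
pose k := C0 / s ^+ 2 + 1.
have k0 : 0 < k by rewrite ltr_wpDl// divr_ge0// exprn_ge0// ltW.
near=> h.
have hs : `|h| <= s by near: h; apply: (@nbhs0_le R 'rV[R]_n).
rewrite -addrA -opprD fa; apply: le_trans (est _ hs) _.
rewrite expr2 mulrA; apply: ler_wpM2r => //.
have hk : `|h| <= e / k.
  by near: h; apply: (@nbhs0_le R 'rV[R]_n); rewrite divr_gt0.
apply: (@le_trans _ _ (k * `|h|)).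
  by apply: ler_wpM2r => //; rewrite lerDl.
by rewrite mulrC -ler_pdivlMr.
Unshelve. all: by end_near. Qed.

End PowerSeries.

(** * Differentiability of the germs, singular sets and Milnor sets *)

(** Coordinates are continuous and commute with finite sums, so each component is a scalar power
    series. *)
Lemma analytic_at_differentiable (R : realType) n m
    (f : 'rV[R]_n -> 'rV[R]_m) a :
  analytic_at f a -> differentiable f a.
Proof.
move=> [c fc]; apply: differentiable_rV => j.
apply: (@power_series_differentiable _ _ (fun alpha => c alpha 0 j)).
apply: filterS fc => x fx.
have := cvg_comp _ _ fx (@coord_continuous _ _ _ 0 j (f x)).
rewrite (_ : _ \o _ = partial_sum
  (fun alpha => monomial alpha (x - a) * c alpha 0 j))//.
apply/funext => A /=; rewrite summxE; apply: eq_bigr => i _.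
by rewrite mxE.
Qed.

(** In [smooth_on], the empty list gives the first partials throughout [U], and one-element lists
    their continuity. *)
Lemma smooth_on_differentiable (R : realType) n (U : set 'rV[R]_n)
    (rho : 'rV[R]_n -> R) x :
  open U -> smooth_on U rho -> U x -> differentiable rho x.
Proof.
move=> oU srho Ux; apply: C1_differentiable => [|i].
  have : \forall y \near x, U y by exact: open_nbhs_nbhs.
  by apply: filterS => y Uy i; have [_] := srho [::] y Uy; apply.
by have [] := srho [:: i] x Ux.
Qed.

(** A product of matrices has rank at most that of its right factor, here the Jacobian of [g]. *)
Lemma Sing_comp (R : realType) n p m (f : 'rV[R]_n -> 'rV[R]_p)
    (g : 'rV[R]_p -> 'rV[R]_m) x :
  differentiable f x -> differentiable g (f x) ->
  Sing g (f x) -> Sing (g \o f) x.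
Proof.
move=> df dg; rewrite /Sing/= jacobian_comp//; apply: leq_ltn_trans.
exact: mxrankM_maxr.
Qed.

Lemma Milnor_setE (R : realType) n m (f : 'rV[R]_n -> 'rV[R]_m)
    (rho : 'rV[R]_n -> R) x :
  differentiable f x -> differentiable rho x ->
  Milnor_set rho f x <->
  Sing f x \/ ((\col_i 'D_(delta_mx 0 i) rho x)^T <= ('J f x)^T)%MS.
Proof.
move=> df drho; rewrite /Milnor_set /Sing/= jacobian_pair_rho//.
by rewrite rank_row_mx_col; split => [/orP|?]; [|apply/orP].
Qed.

Lemma Milnor_set_comp (R : realType) n p m (f : 'rV[R]_n -> 'rV[R]_p)
    (g : 'rV[R]_p -> 'rV[R]_m) (rho : 'rV[R]_n -> R) x :
  differentiable f x -> differentiable g (f x) -> differentiable rho x ->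
  Milnor_set rho (g \o f) x -> Milnor_set rho f x \/ Sing (g \o f) x.
Proof.
move=> df dg drho; have dgf := differentiable_comp df dg.
move=> /(Milnor_setE dgf drho)[|grad]; [by right|left].
apply/(Milnor_setE df drho); right; apply: submx_trans grad _.
by rewrite jacobian_comp// trmx_mul submxMl.
Qed.

Theorem lemma3p4 (R : realType) (M N K : nat)
    (hK : (2 <= K)%N) (hKN : (K <= N)%N) (hNM : (N <= M)%N)
    (U : set 'rV[R]_M) (rho : 'rV[R]_M -> R)
    (hU : open U) (hU0 : U 0) (hrho : control_function U rho)
    (F : 'rV[R]_M -> 'rV[R]_N) (hF : analytic_map_germ F)
    (hDisc : Disc_trivial F)
    (G : 'rV[R]_N -> 'rV[R]_K) (hG : analytic_map_germ G) :
  let H : 'rV[R]_M -> 'rV[R]_K := G \o F in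
  [/\ germ_subset (Sing H) (Milnor_set rho H),
      germ_subset (Milnor_set rho H) (Milnor_set rho F `|` Sing H)
    & germ_subset [set 0] (Sing G) ->
      germ_subset (Milnor_set rho H `\` Sing H)
                  (Milnor_set rho F `\` zero_locus F)].
Proof.
move=> H; have [F0 aF _] := hF; have [_ aG _] := hG; have [srho _ _ _] := hrho.
have dF : \forall x \near 0, differentiable F x.
  by apply: filterS aF => x; exact: analytic_at_differentiable.
have drho : \forall x \near 0, differentiable rho x.
  have : \forall x \near (0 : 'rV[R]_M), U x by exact: open_nbhs_nbhs.
  by apply: filterS => x; exact: smooth_on_differentiable.
have dG : \forall x \near (0 : 'rV[R]_M), differentiable G (F x).
  (* Continuity of [F] at 0 and [F 0 = 0] pull the neighbourhood where [G] is differentiable back to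
     the source. *)
  have cF := differentiable_continuous (nbhs_singleton dF).
  have : \forall y \near F (0 : 'rV[R]_M), differentiable G y.
    by rewrite F0; apply: filterS aG => y; exact: analytic_at_differentiable.
  exact: cF.
(* The origin lies in each of its neighbourhoods, so the inclusion of germs yields [Sing G 0]. *)
split=> [||/nbhs_singleton/(_ erefl) SingG0].
- apply: filterS3 dF dG drho => x dFx dGx drhox SHx.
  by apply/(Milnor_setE (differentiable_comp dFx dGx) drhox); left.
- by apply: filterS3 dF dG drho => x dFx dGx drhox; exact: Milnor_set_comp.
apply: filterS3 dF dG drho => x dFx dGx drhox [MHx nSHx].
have [MFx|/nSHx//] := Milnor_set_comp dFx dGx drhox MHx.
split; first exact: MFx.
move=> Fx0; have {}Fx0 : F x = 0 := Fx0.
by apply: nSHx; apply: (Sing_comp dFx dGx); rewrite Fx0.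
Qed.
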